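(* Let $G$ be a daisy cube. Then the Wiener index $W(G)$ and the Mostar index $\mathit{Mo}(G)$ of $G$ satisfy $$2W(G)-\mathit{Mo}(G)=|V(G)|\,|E(G)|.$$
   Context: Let $B=\{0,1\}$; elements of $B^n$ are written as binary strings $u=u_1\ldots u_n$. The hypercube $Q_n$ has vertex set $B^n$, two vertices being adjacent iff they differ in precisely one coordinate. The distance $d(u,v)$ between two vertices of a connected graph is the number of edges on a shortest $u,v$-path. A subgraph $G$ of a graph $H$ is isometric if the distance in $G$ between any two vertices of $G$ equals their distance in $H$. Let $\le$ be the partial order on $B^n$ with $u\le v$ iff $u_i\le v_i$ for all $i\in\{1,\ldots,n\}$. For $X\subseteq B^n$, the daisy cube generated by $X$ is $Q_n(X)$, the subgraph of $Q_n$ induced by $\{u\in B^n : u\le x \text{ for some } x\in X\}$. A graph $G$ is a daisy cube if there exist an isometric embedding of $G$ in some hypercube $Q_n$ and a subset $X\subseteq B^n$ such that (the image of) $G$ is the daisy cube $Q_n(X)$ generated by $X$. The Wiener index of a connected graph $G$ is $W(G)=\sum_{\{u,v\}\subset V(G)}d(u,v)$, the sum being over unordered pairs of vertices. For an edge $uv\in E(G)$, $n_{u,v}$ denotes the number of vertices of $G$ that are (strictly) closer to $u$ than to $v$. The Mostar index is $\mathit{Mo}(G)=\sum_{uv\in E(G)}|n_{u,v}-n_{v,u}|$, the sum being over the edges of $G$. *)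

(* Defs.v *)
From mathcomp Require Import all_boot all_order all_algebra.

Set Implicit Arguments.
Unset Strict Implicit.
Unset Printing Implicit Defensive.

(* Finite simple graphs. *)
Record sgraph := SGraph {
  vertex :> finType;
  adj : rel vertex;
  adj_sym : symmetric adj;
  adj_irr : irreflexive adj }.

Definition connected (G : sgraph) : Prop :=
  forall u v : G, connect (@adj G) u v.

(* A path from u with k edges is the k-tuple p of its vertices after u. Paths
   have fewer than #|G| edges, so the search finds the length of a shortest one;
   when u and v are not connected it returns the junk value #|G|. *)
Definition dist (G : sgraph) (u v : G) : nat :=
  find (fun k => [exists p : k.-tuple G,
          [&& path (@adj G) u p, uniq (u :: p) & last u p == v]])
       (iota 0 #|G|).

(* Each unordered pair {u, v} with u != v is represented by exactly one of
   (u, v) and (v, u), the one that is increasing for the enumeration of the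
   vertices. Only summands symmetric in u and v are used below. *)
Definition vpairs (G : sgraph) : {set G * G} :=
  [set e : G * G | enum_rank e.1 < enum_rank e.2].

Definition edges (G : sgraph) : {set G * G} :=
  [set e in vpairs G | adj e.1 e.2].

Definition Wiener (G : sgraph) : nat := \sum_(e in vpairs G) dist e.1 e.2.

Definition ncloser (G : sgraph) (u v : G) : nat :=
  #|[set w : G | dist w u < dist w v]|.

Definition Mostar (G : sgraph) : nat :=
  \sum_(e in edges G) `|ncloser e.1 e.2 - ncloser e.2 e.1|%N.

Definition qadj (n : nat) : rel (n.-tuple bool) :=
  fun u v => #|[set i : 'I_n | tnth u i != tnth v i]| == 1.

Lemma qadj_sym n : symmetric (@qadj n).
Proof.
move=> u v; rewrite /qadj; congr (_ == 1).
by apply: eq_card => i; rewrite !inE eq_sym.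
Qed.

Lemma qadj_irr n : irreflexive (@qadj n).
Proof.
move=> u; rewrite /qadj (_ : [set i | _] = set0) ?cards0 //.
by apply/setP=> i; rewrite !inE eqxx.
Qed.

Definition hypercube (n : nat) : sgraph := SGraph (@qadj_sym n) (@qadj_irr n).

Definition qle (n : nat) (u v : n.-tuple bool) : bool :=
  [forall i : 'I_n, tnth u i ==> tnth v i].

(* The vertex set of Q_n(X). *)
Definition daisy_set (n : nat) (X : {set n.-tuple bool}) : {set hypercube n} :=
  [set u : n.-tuple bool | [exists x in X, qle u x]].

(* Connectedness of both graphs makes the distances meaningful: without it, the
   junk value of dist could coincide with an actual distance. *)
Definition isometric_embedding (G H : sgraph) (f : G -> H) : Prop :=
  [/\ connected G, connected H, injective f,
      forall u v : G, adj u v -> adj (f u) (f v)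
    & forall u v : G, dist u v = dist (f u) (f v)].

(* The subgraph f(G) of H, with vertices f(V(G)) and edges f(E(G)), is the
   subgraph of H induced by A. *)
Definition image_is_induced (G H : sgraph) (f : G -> H) (A : {set H}) : Prop :=
  [set f u | u : G] = A /\
  forall x y : H, (exists u v : G, [/\ adj u v, f u = x & f v = y]) <->
                  [/\ x \in A, y \in A & adj x y].

Definition is_daisy_cube (G : sgraph) : Prop :=
  exists (n : nat) (f : G -> hypercube n) (X : {set n.-tuple bool}),
    isometric_embedding f /\ image_is_induced f (daisy_set X).

(* Main.v *)
(* For a direction i of the hypercube, let a_i and b_i be the numbers of
   vertices of G with i-th coordinate 0 and 1. Since G is isometric in the
   hypercube, distances are Hamming distances, so W(G) = \sum_i a_i b_i. Since
   V(G) is a down-set, switching off coordinate i is an injection from the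
   vertices counted by b_i to those counted by a_i, so b_i <= a_i and there are
   b_i edges in direction i. The vertices closer to one end of such an edge are
   those that agree with it in coordinate i, so Mo(G) = \sum_i b_i (a_i - b_i).
   Then 2 W(G) - Mo(G) = \sum_i b_i (a_i + b_i), and a_i + b_i = |V(G)|. *)
Require Import Defs.
From mathcomp Require Import all_boot all_order all_algebra.
From mathcomp Require Import zify.

(** * Distance as the length of a shortest path *)

Local Open Scope nat_scope.

(** Removing loops from a shortest walk leaves its length unchanged, by minimality. A walk without
    repeated vertices has fewer than [#|G|] edges, so the search in [dist] stops at this length and
    not at the junk value. *)
Lemma dist_eq (G : sgraph) (u v : G) (q : seq G) :
  path (@adj G) u q -> last u q = v ->
  (forall p, path (@adj G) u p -> last u p = v -> size q <= size p) ->
  dist u v = size q.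
Proof.
move=> qP qv qmin; rewrite /dist; set P := (X in find X _).
have [p [pP pU pv szp]] : exists p : seq G,
    [/\ path (@adj G) u p, uniq (u :: p), last u p = v & size p = size q].
  have [p [pP pU pv pq]] : exists p : seq G,
      [/\ path (@adj G) u p, uniq (u :: p), last u p = v & {subset p <= q}].
    by rewrite -qv; case/shortenP: qP => p pP pU pq; exists p.
  exists p; split=> //; apply/eqP; rewrite eqn_leq qmin // andbT.
  by apply: uniq_leq_size => //; case/andP: pU.
have Pq : P (size q).
  have szp' : size p == size q by rewrite szp.
  by apply/existsP; exists (Tuple szp'); apply/and3P; split=> //; apply/eqP.
have Pmin k : P k -> size q <= k.
  case/existsP=> t /and3P [tP _ /eqP tv].
  by rewrite -(size_tuple t); apply: qmin.
have qG : size q < #|G|.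
  by have := max_card (mem (u :: p)); rewrite (card_uniqP pU) /= szp.
have hasP : has P (iota 0 #|G|) by apply/hasP; exists (size q); rewrite ?mem_iota.
have := nth_find 0 hasP; have := before_find 0 (a := P) (s := iota 0 #|G|).
rewrite has_find size_iota in hasP; rewrite nth_iota // add0n => noP /Pmin qf.
apply/eqP; rewrite eqn_leq qf andbT leqNgt; apply/negP => /noP.
by rewrite nth_iota // add0n Pq.
Qed.

(** * Bit flips and Hamming distance in the hypercube *)

Definition flip (n : nat) (i : 'I_n) (x : n.-tuple bool) : n.-tuple bool :=
  [tuple (i == j) (+) tnth x j | j < n].

Definition hamming (n : nat) (x y : n.-tuple bool) : nat :=
  \sum_(i < n) (tnth x i != tnth y i).

Lemma tnth_flip (n : nat) (i j : 'I_n) (x : n.-tuple bool) :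
  tnth (flip n i x) j = (i == j) (+) tnth x j.
Proof. by rewrite tnth_mktuple. Qed.

Lemma flipK (n : nat) (i : 'I_n) : involutive (flip n i).
Proof. by move=> x; apply/eq_from_tnth => j; rewrite !tnth_flip addbA addbb. Qed.

Lemma eq_flip_sym (n : nat) (i : 'I_n) (x y : n.-tuple bool) :
  (x == flip n i y) = (y == flip n i x).
Proof. by apply/eqP/eqP => ->; rewrite flipK. Qed.

(** At most one term is nonzero, because the set of differing coordinates determines the direction.
    The sum form lets edge sums be split by direction. *)
Lemma qadjE (n : nat) (x y : n.-tuple bool) :
  qadj x y = \sum_(i < n) (x == flip n i y) :> nat.
Proof.
have flipP i : (x == flip n i y) -> [set j | tnth x j != tnth y j] = [set i].
  move=> /eqP ->; apply/setP => j; rewrite !inE tnth_flip (eq_sym i).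
  by case: (j == i) (tnth y j) => [] [].
rewrite /qadj; case: (boolP (#|_| == 1)) => [/cards1P [i xyi]|nxy].
  have xfy : x == flip n i y.
    apply/eqP/eq_from_tnth => j; rewrite tnth_flip.
    move/setP/(_ j): xyi; rewrite !inE (eq_sym j).
    by case: (i == j) (tnth x j) (tnth y j) => [] [] [].
  rewrite (bigD1 i) //= xfy big1 // => j ji.
  case: (boolP (x == flip n j y)) => // /flipP; rewrite xyi => /set1_inj ij.
  by rewrite ij eqxx in ji.
rewrite big1 // => i _; case: (boolP (x == flip n i y)) => // /flipP xyi.
by rewrite xyi cards1 in nxy.
Qed.

Lemma qadjP (n : nat) (x y : n.-tuple bool) :
  reflect (exists i, x = flip n i y) (qadj x y).
Proof.
apply: (iffP idP) => [xy|[i xfy]].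
  have := qadjE n x y; rewrite xy => /esym/eqP/sum_nat_eq1 [i [_]].
  by case: eqP => // xfy _ _; exists i.
have := qadjE n x y; rewrite (bigD1 i) //= xfy eqxx.
by case: qadj.
Qed.

(** Only the summand at [i] changes. Adding a correction on each side covers steps towards and away
    from [y] without truncated subtraction. *)
Lemma hamming_flip (n : nat) (i : 'I_n) (x y : n.-tuple bool) :
  hamming n (flip n i x) y + (tnth x i != tnth y i)
    = hamming n x y + (tnth x i == tnth y i).
Proof.
rewrite /hamming (bigD1 i) // [in RHS](bigD1 i) //= tnth_flip eqxx.
rewrite (eq_bigr (fun j => (tnth x j != tnth y j) : nat)); last first.
  by move=> j ji; rewrite tnth_flip (eq_sym i) (negPf ji).
by case: (tnth x i) (tnth y i) => [] []; rewrite /= ?addn0 ?add0n // addnC.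
Qed.

Lemma hamming0 (n : nat) (x y : n.-tuple bool) : hamming n x y = 0 -> x = y.
Proof.
move=> /eqP; rewrite sum_nat_eq0 => /forallP xy.
by apply/eq_from_tnth => i; move: (xy i); rewrite eqb0 negbK => /eqP.
Qed.

Lemma hammingxx (n : nat) (x : n.-tuple bool) : hamming n x x = 0.
Proof. by rewrite /hamming big1 // => i _; rewrite eqxx. Qed.

Lemma hamming_le_path (n : nat) (x : hypercube n) (p : seq (hypercube n)) :
  path (@adj (hypercube n)) x p -> hamming n x (last x p) <= size p.
Proof.
elim: p x => [|y p IHp] x /=; first by rewrite hammingxx.
case/andP => /qadjP [i ->] /IHp; have := hamming_flip n i y (last y p).
by case: eqP => _ /=; lia.
Qed.

(** Correcting one differing coordinate at a time gives a path whose length meets the lower bound of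
    [hamming_le_path]. *)
Lemma hamming_path (n : nat) (x y : hypercube n) :
  exists2 p : seq (hypercube n), path (@adj (hypercube n)) x p
    & last x p = y /\ size p = hamming n x y.
Proof.
move xym: (hamming n x y) => m; elim: m x xym => [|m IHm] x.
  by move=> /hamming0 <-; exists [::].
move=> xym; have /existsP [i xyi] : [exists i, tnth x i != tnth y i].
  apply: contra_eqT xym; rewrite negb_exists => /forallP xy.
  by rewrite /hamming big1 // => i _; rewrite (negPf (xy i)).
have := hamming_flip n i x y; rewrite xyi (negPf xyi) xym addn0 addn1 => - [fm].
have [p pP [py szp]] := IHm _ fm.
exists (flip n i x :: p); last by rewrite /= szp.
rewrite /= pP andbT; by apply/qadjP; exists i; rewrite flipK.
Qed.

Lemma dist_hypercube (n : nat) (x y : hypercube n) :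
  dist x y = hamming n x y.
Proof.
have [p pP [py szp]] := hamming_path n x y.
rewrite -szp; apply: dist_eq => // q qP qy.
by rewrite szp -qy hamming_le_path.
Qed.

(** * Double counting over ordered pairs *)

(** Exchanging [u] and [v] in one of two copies of the sum over [r] reverses [r]. Where [F] is
    nonzero exactly one of [r u v] and [r v u] holds, so the two copies together cover all ordered
    pairs. *)
Lemma sum_oriented (T : finType) (r : rel T) (F : T -> T -> nat) :
  (forall u v, F u v = F v u) ->
  (forall u v, F u v != 0 -> r u v = ~~ r v u) ->
  (\sum_u \sum_(v | r u v) F u v).*2 = \sum_u \sum_v F u v.
Proof.
move=> Fsym rF; rewrite -addnn [X in _ + X](exchange_big_dep predT) //= -big_split.
apply: eq_bigr => u _ /=.
rewrite [in RHS](bigID (r u)) /=; congr (_ + _).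
rewrite big_mkcond [RHS]big_mkcond; apply: eq_bigr => v _ /=.
rewrite (Fsym v u); have [Fuv|/rF ->] := eqVneq (F u v) 0; last by rewrite negbK.
by rewrite Fuv !if_same.
Qed.

Lemma sum_vpairs (G : sgraph) (F : G -> G -> nat) :
  (forall u v, F u v = F v u) -> (forall u, F u u = 0) ->
  (\sum_(e in vpairs G) F e.1 e.2).*2 = \sum_u \sum_v F u v.
Proof.
move=> Fsym F0.
rewrite -(sum_oriented G (fun u v => enum_rank u < enum_rank v)) //.
  by rewrite pair_big_dep; congr _.*2; apply: eq_bigl => e; rewrite inE.
move=> u v Fuv; rewrite -leqNgt [RHS]leq_eqVlt.
case: eqVneq => // /val_inj/enum_rank_inj uv.
by rewrite uv F0 in Fuv.
Qed.

Lemma sum_edges (G : sgraph) (F : G -> G -> nat) :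
  (forall u v, F u v = F v u) ->
  (\sum_(e in edges G) F e.1 e.2).*2 = \sum_u \sum_v adj u v * F u v.
Proof.
move=> Fsym; rewrite -sum_vpairs.
- rewrite big_mkcond [in RHS]big_mkcond; congr _.*2; apply: eq_bigr => e _.
  rewrite inE; case: (e \in vpairs G) => //=.
  by case: (adj _ _); rewrite ?mul1n.
- by move=> u v; rewrite adj_sym Fsym.
- by move=> u; rewrite adj_irr.
Qed.

(** * Edges in one direction *)

(** The second hypothesis is closure under switching off coordinate [i], as in a down-set. It
    provides a lower neighbour for each [v] counted here, and injectivity makes it unique. *)
Lemma sum_flip_up (T : finType) (n : nat) (f : T -> n.-tuple bool) (i : 'I_n) :
  injective f ->
  (forall v, tnth (f v) i -> exists u, f u = flip n i (f v)) ->
  \sum_(v | tnth (f v) i) \sum_u (f u == flip n i (f v))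
    = #|[set v | tnth (f v) i]|.
Proof.
move=> f_inj down; rewrite -sum1dep_card; apply: eq_bigr => v /down [w <-].
rewrite (bigD1 w) //= eqxx big1 // => u uw.
by rewrite (inj_eq f_inj) (negPf uw).
Qed.

Lemma sum_flip (T : finType) (n : nat) (f : T -> n.-tuple bool) (i : 'I_n) :
  injective f ->
  (forall v, tnth (f v) i -> exists u, f u = flip n i (f v)) ->
  \sum_u \sum_v (f u == flip n i (f v)) = #|[set v | tnth (f v) i]|.*2.
Proof.
move=> f_inj down; rewrite -(sum_flip_up _ _ _ _ f_inj down).
rewrite -(sum_oriented _ (fun v u => tnth (f v) i)).
- congr _.*2; rewrite [RHS]big_mkcond; apply: eq_bigr => v _.
  case: ifP => fv; last by rewrite big_pred0_eq.
  by apply: eq_bigr => u _; rewrite eq_flip_sym.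
- by move=> u v; rewrite eq_flip_sym.
- move=> u v; rewrite eqb0 negbK => /eqP ->.
  by rewrite tnth_flip eqxx.
Qed.

(** The edges in direction [i], one for each upper vertex, are recounted by their lower ends; each
    lower vertex lies on at most one. *)
Lemma card_upper_le (T : finType) (n : nat) (f : T -> n.-tuple bool) (i : 'I_n) :
  injective f ->
  (forall v, tnth (f v) i -> exists u, f u = flip n i (f v)) ->
  #|[set v | tnth (f v) i]| <= #|[set v | ~~ tnth (f v) i]|.
Proof.
move=> f_inj down; rewrite -(sum_flip_up _ _ _ _ f_inj down).
rewrite exchange_big (bigID (fun u => tnth (f u) i)) /= big1 ?add0n; last first.
  move=> u fu; rewrite big1 // => v fv.
  by case: eqP => // fuv; rewrite fuv tnth_flip eqxx fv in fu.
rewrite -sum1dep_card; apply: leq_sum => u _.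
rewrite (eq_bigr (fun v => (flip n i (f u) == f v) : nat)); last first.
  by move=> v _; rewrite eq_flip_sym eq_sym.
have [w fw|no] := pickP (fun w => flip n i (f u) == f w).
  rewrite big_mkcond (bigD1 w) //= big1 ?addn0; first by case: ifP; rewrite ?leq_b1.
  by move=> v vw; rewrite (eqP fw) (inj_eq f_inj) eq_sym (negPf vw) if_same.
by rewrite big1 // => v _; rewrite no.
Qed.

Lemma sum_neq (T : finType) (P : pred T) :
  \sum_u \sum_v (P u != P v) = (#|[set v | P v]| * #|[set v | ~~ P v]|).*2.
Proof.
rewrite -(sum_oriented _ (fun u v => P u)).
- congr _.*2; rewrite -sum1dep_card big_distrl /= [RHS]big_mkcond.
  apply: eq_bigr => u _; case: ifP => Pu; last by rewrite big_pred0_eq.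
  rewrite mul1n -sum1dep_card [RHS]big_mkcond; apply: eq_bigr => v _.
  by case: (P v).
- by move=> u v; rewrite eq_sym.
- by move=> u v; case: (P u) (P v) => [] [].
Qed.

Local Open Scope ring_scope.

Theorem theorem3p1 (G : sgraph) (hG : is_daisy_cube G) :
  2 * (Wiener G)%:Z - (Mostar G)%:Z = (#|G|)%:Z * (#|edges G|)%:Z.
Proof.
have [n [f [X [[_ _ f_inj f_adj f_dist] [f_img f_ind]]]]] := hG.
have distE u v : dist u v = hamming n (f u) (f v).
  by rewrite f_dist dist_hypercube.
have adjE u v : adj u v = qadj (f u) (f v).
  apply/idP/idP => [/f_adj //|fuv].
  (* The image is an induced subgraph, so this edge comes from an edge of [G], whose ends are [u]
     and [v] by injectivity. *)
  have [_ /(_ _)] := f_ind (f u) (f v).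
  case; first by rewrite -f_img !imset_f.
  by move=> u' [v' [uv' /f_inj <- /f_inj <-]].
have down i v : tnth (f v) i -> exists u, f u = flip n i (f v).
  move=> fvi; have : flip n i (f v) \in daisy_set X.
    have : f v \in daisy_set X by rewrite -f_img imset_f.
    rewrite !inE => /existsP [x /andP [xX /forallP vx]].
    (* Flipping a coordinate that is on only lowers the string, so the same generator [x] works. *)
    apply/existsP; exists x; rewrite xX; apply/forallP => j.
    rewrite tnth_flip; case: eqP => [<-|_]; last exact: vx.
    by rewrite fvi.
  by rewrite -f_img => /imsetP [u _ ->]; exists u.
pose b i := #|[set v | tnth (f v) i]|.
pose a i := #|[set v | ~~ tnth (f v) i]|.
have ab i : (b i + a i = #|G|)%N.
  rewrite -(cardsC [set v | tnth (f v) i]); congr (_ + _)%N.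
  by apply: eq_card => v; rewrite !inE.
have ba i : (b i <= a i)%N by apply: card_upper_le f_inj (down i).
have nclE i u v : f u = flip n i (f v) ->
    ncloser u v = #|[set w | tnth (f w) i == tnth (f u) i]|.
  move=> fuv; apply: eq_card => w; rewrite !inE !distE.
  rewrite (_ : hamming n (f w) (f v) = hamming n (f v) (f w)); last first.
    by apply: eq_bigr => j _; rewrite eq_sym.
  rewrite (_ : hamming n (f w) (f u) = hamming n (f u) (f w)); last first.
    by apply: eq_bigr => j _; rewrite eq_sym.
  (* The distances from [w] to the two ends differ by one, and coordinate [i] of [w] decides which
     is smaller. *)
  have := hamming_flip n i (f v) (f w); rewrite -fuv.
  have -> : tnth (f u) i = ~~ tnth (f v) i by rewrite fuv tnth_flip eqxx.
  by case: (tnth (f v) i) (tnth (f w) i) => [] [] /=; lia.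
have nclD i u v : f u = flip n i (f v) ->
    `|ncloser u v - ncloser v u|%N = (a i - b i)%N.
  move=> fuv; rewrite (nclE i) // (nclE i v u); last by rewrite fuv flipK.
  have -> : tnth (f u) i = ~~ tnth (f v) i by rewrite fuv tnth_flip eqxx.
  have aE : #|[set w | tnth (f w) i == false]| = a i.
    by apply: eq_card => w; rewrite !inE eqbF_neg.
  have bE : #|[set w | tnth (f w) i == true]| = b i.
    by apply: eq_card => w; rewrite !inE eqb_id.
  by have := ba i; case: (tnth (f v) i); rewrite /= aE bE; lia.
have edge_sum (F : G -> G -> nat) (K : 'I_n -> nat) :
    (forall u v, F u v = F v u) ->
    (forall i u v, f u = flip n i (f v) -> F u v = K i) ->
    (\sum_(e in edges G) F e.1 e.2 = \sum_i b i * K i)%N.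
  (* Doubling turns the edge sum into one over ordered pairs, which [qadjE] splits by direction; by
     [sum_flip], direction [i] contributes [2 * b i] of them. *)
  move=> Fsym FK; apply: double_inj; rewrite sum_edges //.
  under eq_bigr => u _ do under eq_bigr => v _ do
    rewrite adjE qadjE big_distrl /=.
  under eq_bigr => u _ do rewrite exchange_big /=.
  rewrite exchange_big -mul2n big_distrr /=; apply: eq_bigr => i _.
  rewrite mulnA mul2n -sum_flip //; last exact: down.
  rewrite big_distrl; apply: eq_bigr => u _.
  rewrite big_distrl; apply: eq_bigr => v _ /=.
  by case: eqP => // /FK ->.
have edgesE : #|edges G| = (\sum_i b i)%N.
  rewrite -sum1_card (edge_sum (fun _ _ => 1%N) (fun _ => 1%N)) //.
  by apply: eq_bigr => i _; rewrite muln1.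
have MostarE : Mostar G = (\sum_i b i * (a i - b i))%N.
  apply: (edge_sum (fun u v => `|ncloser u v - ncloser v u|%N)) => //.
  by move=> u v; rewrite distnC.
have WienerE : Wiener G = (\sum_i b i * a i)%N.
  apply: double_inj; rewrite sum_vpairs.
  - under eq_bigr => u _ do under eq_bigr => v _ do rewrite distE.
    under eq_bigr => u _ do rewrite exchange_big /=.
    rewrite exchange_big -[in RHS]mul2n big_distrr /=; apply: eq_bigr => i _.
    by rewrite sum_neq mul2n.
  - by move=> u v; rewrite !distE; apply: eq_bigr => j _; rewrite eq_sym.
  - by move=> u; rewrite distE hammingxx.
have key : (2 * Wiener G = Mostar G + #|G| * #|edges G|)%N.
  rewrite WienerE MostarE edgesE !big_distrr -big_split /=.
  (* Replacing [a i] by [b i + (a i - b i)] makes the truncated difference an independent quantity,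
     so the identity becomes polynomial. *)
  apply: eq_bigr => i _; rewrite -(ab i) -(subnKC (ba i)) addKn; lia.
lia.
Qed.
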